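(* For every finite $n\ge 2$, the class $CSA_n$ of completely representable algebras in $SA_n$ is elementary and finitely axiomatizable in first order logic.
   Context: For distinct $i,j<n$, $[i,j]$ is the transposition of $n=\{0,\dots,n-1\}$ swapping $i$ and $j$, and $[i|j]$ is the map $n\to n$ sending $i$ to $j$ and fixing everything else. For a set $U$, a set $V\subseteq{}^nU$ is locally square if $s\circ[i|j],\,s\circ[i,j]\in V$ for all $s\in V$ and $i\ne j\in n$; then $\wp(V)=\langle\mathcal P(V);\cap,\sim,S^i_j,S_{ij}\rangle_{i\neq j\in n}$ with $\sim$ complement in $V$, $S^i_j(X)=\{q\in V:q\circ[i|j]\in X\}$, $S_{ij}(X)=\{q\in V:q\circ[i,j]\in X\}$. Abstract algebras have the type $\{\cdot,-,s^i_j,s_{ij}\}_{i\neq j\in n}$. $SA_n=\mathbf{Mod}(\Sigma_n)$, where $\Sigma_n$ is the following finite set of equations: (a) the Boolean algebra axioms; (b) each $s_{ij}$ and each $s^i_j$ is a Boolean endomorphism; (c) for a fixed finite presentation of the monoid ${}^nn$ (all maps $n\to n$ under composition) in the generators $[i,j],[i|j]$, all equations $s_{g_1}\cdots s_{g_m}x=s_{h_1}\cdots s_{h_k}x$ for the defining relations $g_1\circ\cdots\circ g_m=h_1\circ\cdots\circ h_k$, where $s_{[i,j]}=s_{ij}$ and $s_{[i|j]}=s^i_j$. (The class does not depend on the choice of presentation.) A representation of $\mathfrak A$ is an injective homomorphism $f:\mathfrak A\to\wp(V)$ with $V$ locally square; it is complete if $f(\prod X)=\bigcap_{x\in X}f(x)$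 for every $X\subseteq\mathfrak A$ whose meet $\prod X$ exists in $\mathfrak A$. $\mathfrak A$ is completely representable if it has a complete representation. *)

(* Defs.v *)
From Stdlib Require List.
From mathcomp Require Import all_boot all_fingroup.
From mathcomp Require Import boolp classical_sets.

Set Implicit Arguments.
Unset Strict Implicit.
Unset Printing Implicit Defensive.

Local Open Scope classical_set_scope.

(** ** Transpositions and replacements as formal generators *)

Definition distinct_pair (n : nat) := {ij : 'I_n * 'I_n | ij.1 != ij.2}.

(* [inl (i, j)] stands for the replacement [i|j] and [inr (i, j)] for the
   transposition [i,j]. The symbols [inr (i, j)] and [inr (j, i)] are distinct,
   although they denote the same map. *)
Definition gen (n : nat) := (distinct_pair n + distinct_pair n)%type.

Definition replacement (n : nat) (i j : 'I_n) : 'I_n -> 'I_n :=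
  fun k => if k == i then j else k.

Definition gen_map (n : nat) (g : gen n) : 'I_n -> 'I_n :=
  match g with
  | inl ij => replacement (val ij).1 (val ij).2
  | inr ij => tperm (val ij).1 (val ij).2
  end.

(** ** Finite presentations of the monoid of all maps on ['I_n] *)

Definition word (n : nat) := seq (gen n).

(* The word [:: g1; ...; gm] denotes g1 \o ... \o gm. *)
Definition word_map (n : nat) (w : word n) : 'I_n -> 'I_n :=
  foldr (fun g f => gen_map g \o f) id w.

Inductive word_cong (n : nat) (R : seq (word n * word n)) :
    word n -> word n -> Prop :=
| wc_rel u v : List.In (u, v) R -> word_cong R u v
| wc_refl u : word_cong R u u
| wc_sym u v : word_cong R u v -> word_cong R v u
| wc_trans u v w : word_cong R u v -> word_cong R v w -> word_cong R u w
| wc_cat u u' v v' :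
    word_cong R u u' -> word_cong R v v' -> word_cong R (u ++ v) (u' ++ v').

(* [word_map] induces an isomorphism from the free monoid on [gen n] modulo
   [word_cong R] onto the monoid of all maps. *)
Definition is_presentation (n : nat) (R : seq (word n * word n)) : Prop :=
  (forall t : 'I_n -> 'I_n, exists w : word n, word_map w =1 t) /\
  (forall u v : word n, word_map u =1 word_map v <-> word_cong R u v).

(** ** Algebras of type {., -, s^i_j, s_ij} with i <> j *)

(* [op_s A (inl (i, j))] is s^i_j and [op_s A (inr (i, j))] is s_ij. *)
Record algebra (n : nat) := Algebra {
  carrier :> Type;
  op_meet : carrier -> carrier -> carrier;
  op_compl : carrier -> carrier;
  op_s : gen n -> carrier -> carrier;
  carrier_inhabited : inhabited carrier
}.

Arguments op_meet {n} a _ _.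
Arguments op_compl {n} a _.
Arguments op_s {n} a _ _.

(** ** First-order logic with equality over this type *)

Inductive term (n : nat) :=
| Var of nat
| Meet of term n & term n
| Compl of term n
| Sub of gen n & term n.

Arguments Var {n} _.

Inductive formula (n : nat) :=
| Equal of term n & term n
| Bot
| Imp of formula n & formula n
| And of formula n & formula n
| Or of formula n & formula n
| All of nat & formula n
| Ex of nat & formula n.

Arguments Bot {n}.

Fixpoint term_vars (n : nat) (t : term n) : seq nat :=
  match t with
  | Var k => [:: k]
  | Meet t1 t2 => term_vars t1 ++ term_vars t2
  | Compl t1 => term_vars t1
  | Sub _ t1 => term_vars t1
  end.

Fixpoint free_vars (n : nat) (p : formula n) : seq nat :=
  match p with
  | Equal t u => term_vars t ++ term_vars u
  | Bot => [::]
  | Imp p1 p2 | And p1 p2 | Or p1 p2 => free_vars p1 ++ free_vars p2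
  | All k p1 | Ex k p1 => [seq x <- free_vars p1 | x != k]
  end.

Definition sentence (n : nat) (p : formula n) : Prop := free_vars p = [::].

Fixpoint eval (n : nat) (A : algebra n) (e : nat -> A) (t : term n) : A :=
  match t with
  | Var k => e k
  | Meet t1 t2 => op_meet A (eval e t1) (eval e t2)
  | Compl t1 => op_compl A (eval e t1)
  | Sub g t1 => op_s A g (eval e t1)
  end.

Definition update (T : Type) (e : nat -> T) (k : nat) (a : T) : nat -> T :=
  fun x => if x == k then a else e x.

Fixpoint sat (n : nat) (A : algebra n) (e : nat -> A) (p : formula n) : Prop :=
  match p with
  | Equal t u => eval e t = eval e u
  | Bot => False
  | Imp p1 p2 => sat e p1 -> sat e p2
  | And p1 p2 => sat e p1 /\ sat e p2
  | Or p1 p2 => sat e p1 \/ sat e p2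
  | All k p1 => forall a : A, sat (update e k a) p1
  | Ex k p1 => exists a : A, sat (update e k a) p1
  end.

Definition models (n : nat) (A : algebra n) (p : formula n) : Prop :=
  forall e : nat -> A, sat e p.

Definition axiomatizes (n : nat) (T : set (formula n))
    (K : algebra n -> Prop) : Prop :=
  (forall p, T p -> sentence p) /\
  (forall A : algebra n, K A <-> (forall p, T p -> models A p)).

Definition elementary (n : nat) (K : algebra n -> Prop) : Prop :=
  exists T : set (formula n), axiomatizes T K.

Definition finitely_axiomatizable (n : nat) (K : algebra n -> Prop) : Prop :=
  exists T : seq (formula n), axiomatizes [set p | List.In p T] K.

(** ** The variety SA_n *)

Definition equation (n : nat) := (term n * term n)%type.

Definition Mod (n : nat) (E : seq (equation n)) (A : algebra n) : Prop :=
  forall q, List.In q E -> models A (Equal q.1 q.2).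

Definition Join (n : nat) (t u : term n) : term n :=
  Compl (Meet (Compl t) (Compl u)).

(* The constants 0 and 1 are not in the type; they appear as [y . -y] and
   [y + -y]. *)
Definition boolean_axioms (n : nat) : seq (equation n) :=
  let x := Var 0 in let y := Var 1 in let z := Var 2 in
  [:: (Meet x y, Meet y x);
      (Join x y, Join y x);
      (Meet x (Meet y z), Meet (Meet x y) z);
      (Join x (Join y z), Join (Join x y) z);
      (Meet x (Join x y), x);
      (Join x (Meet x y), x);
      (Meet x (Join y z), Join (Meet x y) (Meet x z));
      (Join x (Meet y z), Meet (Join x y) (Join x z));
      (Meet x (Join y (Compl y)), x);
      (Join x (Meet y (Compl y)), x)].

Definition endomorphism_axioms (n : nat) (g : gen n) : seq (equation n) :=
  let x := Var 0 in let y := Var 1 in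
  [:: (Sub g (Meet x y), Meet (Sub g x) (Sub g y));
      (Sub g (Compl x), Compl (Sub g x))].

Definition word_term (n : nat) (w : word n) : term n :=
  foldr (@Sub n) (Var 0) w.

Definition Sigma (n : nat) (R : seq (word n * word n)) : seq (equation n) :=
  boolean_axioms n
  ++ flatten [seq endomorphism_axioms g | g <- enum {: gen n}]
  ++ [seq (word_term r.1, word_term r.2) | r <- R].

Definition SA (n : nat) (R : seq (word n * word n)) (A : algebra n) : Prop :=
  Mod (Sigma R) A.

(** ** Set algebras on locally square sets *)

Definition locally_square (n : nat) (U : Type) (V : set ('I_n -> U)) : Prop :=
  forall s, V s -> forall g : gen n, V (s \o gen_map g).

Section SetAlgebra.
Variables (n : nat) (U : Type) (V : set ('I_n -> U)).

Definition subset_of := {X : set ('I_n -> U) | X `<=` V}.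

Definition wp_meet (X Y : subset_of) : subset_of :=
  exist _ (sval X `&` sval Y) (subIset (or_introl (svalP X))).

Definition wp_compl (X : subset_of) : subset_of :=
  exist _ (V `\` sval X) (@subDsetl _ V (sval X)).

Definition wp_s (g : gen n) (X : subset_of) : subset_of :=
  exist _ (V `&` [set q : 'I_n -> U | sval X (q \o gen_map g)]) (@subIsetl _ V _).

Definition wp : algebra n :=
  Algebra wp_meet wp_compl wp_s
    (inhabits (exist (fun X => X `<=` V) V (@subset_refl _ V))).

End SetAlgebra.

(** ** Complete representations *)

Definition homomorphism (n : nat) (A B : algebra n) (f : A -> B) : Prop :=
  [/\ forall x y, f (op_meet A x y) = op_meet B (f x) (f y),
      forall x, f (op_compl A x) = op_compl B (f x)
    & forall g x, f (op_s A g x) = op_s B g (f x)].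

Definition representation (n : nat) (A : algebra n) (U : Type)
    (V : set ('I_n -> U)) (f : A -> wp V) : Prop :=
  [/\ locally_square V, homomorphism f & injective f].

Definition alg_le (n : nat) (A : algebra n) (x y : A) : Prop :=
  op_meet A x y = x.

Definition is_meet (n : nat) (A : algebra n) (X : set A) (m : A) : Prop :=
  (forall x, X x -> alg_le m x) /\
  (forall l, (forall x, X x -> alg_le l x) -> alg_le l m).

(* The intersection is taken in the powerset of [V], so that it is [V] when
   [X] is empty. *)
Definition complete (n : nat) (A : algebra n) (U : Type)
    (V : set ('I_n -> U)) (f : A -> wp V) : Prop :=
  forall (X : set A) (m : A), is_meet X m ->
    sval (f m) = V `&` \bigcap_(x in X) sval (f x).

Definition completely_representable (n : nat) (A : algebra n) : Prop :=
  exists (U : Type) (V : set ('I_n -> U)) (f : A -> wp V),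
    representation f /\ complete f.

Definition CSA (n : nat) (R : seq (word n * word n)) (A : algebra n) : Prop :=
  SA R A /\ completely_representable A.

(* Main.v *)
From Stdlib Require List.
Require Import Defs.
From mathcomp Require Import all_boot.
From mathcomp Require Import boolp classical_sets.

(* An algebra in SA_n is completely representable iff it is atomic and, for
   each generator g, every atom c lies below s_g b for some atom b; both
   conditions are first order, and there are finitely many generators.

   Necessity: in a complete representation f, the elements a with q in f a form
   an ultrafilter whose lower bounds, if it contained no atom, would all be
   zero; so its meet would be zero and completeness would put q in f 0.  Hence
   every point of the unit lies in f a for an atom a, and applying this to the
   points q and q \o [g] gives the two conditions.

   Sufficiency: to every atom c attach a copy of the square of all maps
   t : n -> n, and put (c, t) in f x iff c <= s_t x.  This represents the
   algebra on the disjoint union of these squares.  Iterating the condition on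
   generators, c <= s_t b for some atom b, so c <= s_t x iff b <= x; the right
   side commutes with all existing meets. *)

Set Implicit Arguments.
Unset Strict Implicit.
Unset Printing Implicit Defensive.

Local Open Scope classical_set_scope.

(** * List membership and instances of listed equations *)

Lemma In_mem (T : eqType) (s : seq T) (x : T) : x \in s -> List.In x s.
Proof.
elim: s => //= y s IH; rewrite inE => /orP[/eqP->|/IH]; first by left.
by right.
Qed.

Lemma In_map (T S : Type) (h : T -> S) (s : seq T) (y : S) :
  List.In y [seq h x | x <- s] <-> exists2 x, List.In x s & h x = y.
Proof.
elim: s => [|x s IH] /=; first by split=> // -[].
rewrite IH; split=> [[<-|[z sz <-]]|[z [->|sz] <-]].
- by exists x => //; left.
- by exists z => //; right.
- by left.
- by right; exists z.
Qed.

Lemma In_cat (T : Type) (s t : seq T) (x : T) :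
  List.In x (s ++ t) <-> List.In x s \/ List.In x t.
Proof. by split; [exact: List.in_app_or | exact: List.in_or_app]. Qed.

Lemma In_flatten (T : Type) (ss : seq (seq T)) (s : seq T) (x : T) :
  List.In s ss -> List.In x s -> List.In x (flatten ss).
Proof.
elim: ss => //= t ss IH [->|ss_s] sx; apply/In_cat; first by left.
by right; apply: IH.
Qed.

(** The default pair is a trivial equation, so an index past the end of [E] is harmless. *)
Lemma Mod_nth (n : nat) (E : seq (equation n)) (A : algebra n) k (e : nat -> A) :
  let q := nth (Var 0, Var 0) E k in Mod E A -> eval e q.1 = eval e q.2.
Proof.
elim: E k => [|q E IH] [|k] //= EA; first by apply: (EA q); left.
by apply: IH => r Er; apply: EA; right.
Qed.

(** * Universal closures of formulas *)

Section UniversalClosure.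
Variable n : nat.
Implicit Types p : formula n.

Definition closure p : formula n := foldr (@All n) p (free_vars p).

Lemma closure_sentence p : sentence (closure p).
Proof.
rewrite /sentence /closure.
have fvE s : free_vars (foldr (@All n) p s) = [seq x <- free_vars p | x \notin s].
  elim: s => [|k s IH] /=; first by rewrite filter_predT.
  by rewrite IH -filter_predI; apply: eq_filter => x; rewrite /= inE negb_or.
(* Filtering a list by nonmembership in itself leaves nothing. *)
rewrite fvE; apply/eqP; rewrite -size_eq0 size_filter -leqn0 leqNgt -has_count.
by apply/hasPn => x; rewrite negbK.
Qed.

Lemma models_closure (A : algebra n) p : models A (closure p) <-> models A p.
Proof.
rewrite /closure; elim: (free_vars p) => //= k s <-; split=> [Ap e|Ap e a].
  have -> : e = update e k (e k).
    by apply: funext => x; rewrite /update; case: eqP => [->|].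
  exact: Ap.
exact: Ap.
Qed.

End UniversalClosure.

(** * First-order axioms: atomicity and covering by atoms *)

Section Axiomatization.
Variable n : nat.

(** The type has no constant for zero; the meet of [x] with its complement replaces it. *)
Definition nonzero (A : algebra n) (x : A) : Prop :=
  x <> op_meet A x (op_compl A x).

Definition atom (A : algebra n) (a : A) : Prop :=
  nonzero a /\
  forall x, alg_le a x \/ op_meet A a x = op_meet A a (op_compl A a).

Definition atomic (A : algebra n) : Prop :=
  forall x : A, nonzero x -> exists a, atom a /\ alg_le a x.

Definition atom_covered (A : algebra n) (g : gen n) : Prop :=
  forall c : A, atom c -> exists b, atom b /\ alg_le c (op_s A g b).

Definition nonzero_formula (k : nat) : formula n :=
  Imp (Equal (Var k) (Meet (Var k) (Compl (Var k)))) Bot.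

(* The bound variable is 2, so [k] must not be 2. *)
Definition atom_formula (k : nat) : formula n :=
  And (nonzero_formula k)
      (All 2 (Or (Equal (Meet (Var k) (Var 2)) (Var k))
                 (Equal (Meet (Var k) (Var 2)) (Meet (Var k) (Compl (Var k)))))).

Definition atomic_formula : formula n :=
  Imp (nonzero_formula 0)
      (Ex 1 (And (atom_formula 1) (Equal (Meet (Var 1) (Var 0)) (Var 1)))).

Definition atom_covered_formula (g : gen n) : formula n :=
  Imp (atom_formula 0)
      (Ex 1 (And (atom_formula 1) (Equal (Meet (Var 0) (Defs.Sub g (Var 1))) (Var 0)))).

(** Satisfaction computes to the condition itself, read at the value of variable 0. *)
Lemma models_atomic (A : algebra n) : models A atomic_formula <-> atomic A.
Proof. by split=> [At x|At e]; [exact: (At (fun=> x))|exact: (At (e 0))]. Qed.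

Lemma models_atom_covered (A : algebra n) (g : gen n) :
  models A (atom_covered_formula g) <-> atom_covered A g.
Proof. by split=> [At x|At e]; [exact: (At (fun=> x))|exact: (At (e 0))]. Qed.

Definition CSA_axioms (R : seq (word n * word n)) : seq (formula n) :=
  [seq closure (Equal q.1 q.2) | q <- Sigma R]
  ++ closure atomic_formula
  :: [seq closure (atom_covered_formula g) | g <- enum {: gen n}].

Lemma CSA_axioms_sentence R p : List.In p (CSA_axioms R) -> sentence p.
Proof.
case/In_cat => [/In_map[q _ <-]|/= [<-|/In_map[g _ <-]]];
  exact: closure_sentence.
Qed.

Lemma models_CSA_axioms R (A : algebra n) :
  (forall p, List.In p (CSA_axioms R) -> models A p) <->
  [/\ SA R A, atomic A & forall g, atom_covered A g].
Proof.
split=> [AT|[SA_A At_A cov_A] p].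
  split.
  - move=> q Rq; apply/models_closure/AT/In_cat; left.
    by apply/In_map; exists q.
  - by apply/models_atomic/models_closure/AT/In_cat; right; left.
  - move=> g; apply/models_atom_covered/models_closure/AT/In_cat.
    by right; right; apply/In_map; exists g => //; apply: In_mem; rewrite mem_enum.
case/In_cat => [/In_map[q Rq <-]|/= [<-|/In_map[g _ <-]]];
  apply/models_closure.
- exact: SA_A.
- exact/models_atomic.
- exact/models_atom_covered.
Qed.

End Axiomatization.

(** * Necessity: atoms through the points of a complete representation *)

Section Necessity.
Variables (n : nat) (A : algebra n) (U : Type) (V : set ('I_n -> U)).
Variable f : A -> wp V.
Hypotheses (rep_f : representation f) (comp_f : complete f).

Local Notation F x := (sval (f x)).

Lemma rep_meet x y : F (op_meet A x y) = F x `&` F y.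
Proof. by case: rep_f => _ [-> _ _] _. Qed.

Lemma rep_compl x : F (op_compl A x) = V `\` F x.
Proof. by case: rep_f => _ [_ -> _] _. Qed.

Lemma rep_s g x : F (op_s A g x) = V `&` [set q : 'I_n -> U | F x (q \o gen_map g)].
Proof. by case: rep_f => _ [_ _ ->] _. Qed.

Lemma rep_inj x y : F x = F y -> x = y.
Proof.
case: rep_f => _ _ inj_f Fxy; apply: inj_f.
by move: (f x) (f y) Fxy => [X XV] [Y YV] /= XY; apply: eq_exist.
Qed.

Lemma rep_zero x : F (op_meet A x (op_compl A x)) = set0.
Proof. by rewrite rep_meet rep_compl setICA setICr ?setI0 // setDE. Qed.

Lemma rep_le x y : alg_le x y <-> F x `<=` F y.
Proof.
split=> [xy|/setIidPl xy]; last by apply: rep_inj; rewrite rep_meet.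
by apply/setIidPl; rewrite -rep_meet xy.
Qed.

Lemma rep_nonzero x : nonzero x <-> F x !=set0.
Proof.
split=> [x0|[q Fxq] x0]; last by move: Fxq; rewrite x0 rep_zero.
by apply/set0P/eqP => Fx0; apply: x0; apply: rep_inj; rewrite rep_zero.
Qed.

Lemma point_atom q : V q -> exists a, atom a /\ F a q.
Proof.
move=> Vq; apply: contrapT => no_atom.
case: (carrier_inhabited A) => x0.
have zero_meet : is_meet [set a | F a q] (op_meet A x0 (op_compl A x0)).
  split=> [x _|l lb_l]; first by apply/rep_le; rewrite rep_zero.
  apply/rep_le => t Flt; exfalso.
  (* If [F x] misses [q], the complement of [x] is in the ultrafilter at [q], hence above the lower
     bound [l]. *)
  have Fl_compl x : ~ F x q -> F l `<=` V `\` F x.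
    move=> nFxq; rewrite -rep_compl; apply/rep_le/lb_l.
    by rewrite /= rep_compl.
  (* If [F l] missed [q], then [l] would lie below its own complement, yet [t] is in [F l]. *)
  have [Flq|nFlq] := pselect (F l q); last by case: (Fl_compl _ nFlq _ Flt).
  apply: no_atom; exists l; split=> //; split; first by apply/rep_nonzero; exists t.
  move=> x; have [Fxq|nFxq] := pselect (F x q); first by left; apply: lb_l.
  right; apply: rep_inj; rewrite rep_zero rep_meet.
  by apply/seteqP; split=> // u [/(Fl_compl _ nFxq)[]].
have := comp_f zero_meet; rewrite rep_zero => /seteqP[_ /(_ q)]; apply.
by split.
Qed.

Lemma completely_representable_atomic : atomic A.
Proof.
move=> x /rep_nonzero[q Fxq].
have [a [[a0 at_a] Faq]] := point_atom (svalP (f x) q Fxq).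
exists a; split=> //; case: (at_a x) => // ax0.
have : F (op_meet A a x) q by rewrite rep_meet.
by rewrite ax0 rep_zero.
Qed.

Lemma completely_representable_atom_covered g : atom_covered A g.
Proof.
move=> c [/rep_nonzero[q Fcq] at_c].
have Vq := svalP (f c) q Fcq.
have [sqV _ _] := rep_f.
have [b [at_b Fbq]] := point_atom (sqV _ Vq g).
(* Since [b] holds at [q \o gen_map g], both [c] and [s_g b] hold at [q], so they are not
   disjoint. *)
exists b; split=> //; case: (at_c (op_s A g b)) => // cb0.
have : F (op_meet A c (op_s A g b)) q by rewrite rep_meet rep_s.
by rewrite cb0 rep_zero.
Qed.

End Necessity.

(** * Boolean laws and substitutions along words in SA_n *)

Definition subst (n : nat) (A : algebra n) (w : word n) (x : A) : A :=
  foldr (op_s A) x w.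

Lemma word_map_cat (n : nat) (u v : word n) :
  word_map (u ++ v) =1 word_map u \o word_map v.
Proof. by move=> i; elim: u => //= g u ->. Qed.

Section SubstitutionAlgebra.
Variables (n : nat) (R : seq (word n * word n)) (A : algebra n).
Hypothesis SA_A : SA R A.
Implicit Types b c x y z : A.

Local Notation "x ∧ y" := (op_meet A x y) (at level 40, left associativity).
Local Notation "¬ x" := (op_compl A x) (at level 35, right associativity).
Local Notation "x ∨ y" := (¬ (¬ x ∧ ¬ y)) (at level 50, left associativity).

Lemma Mod_boolean_axioms : Mod (boolean_axioms n) A.
Proof. by move=> q Bq; apply/SA_A/In_cat; left. Qed.

Lemma Mod_endomorphism_axioms g : Mod (endomorphism_axioms g) A.
Proof.
move=> q gq; apply/SA_A/In_cat; right; apply/In_cat; left.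
apply: In_flatten gq; apply/In_map; exists g => //.
by apply: In_mem; rewrite mem_enum.
Qed.

(** Here [k] is a position in [boolean_axioms]; the environment sends variables 0 and 1 to [x] and
    [y], all others to [z]. *)
Let boolean_axiom k (x y z : A) :=
  Mod_nth k (fun i => nth z [:: x; y] i) Mod_boolean_axioms.

Lemma meetC x y : x ∧ y = y ∧ x.
Proof. exact: (boolean_axiom 0 x y x). Qed.

Lemma joinC x y : x ∨ y = y ∨ x.
Proof. exact: (boolean_axiom 1 x y x). Qed.

Lemma meetA x y z : x ∧ (y ∧ z) = x ∧ y ∧ z.
Proof. exact: (boolean_axiom 2 x y z). Qed.

Lemma meetKU x y : x ∧ (x ∨ y) = x.
Proof. exact: (boolean_axiom 4 x y x). Qed.

Lemma meetUr x y z : x ∧ (y ∨ z) = (x ∧ y) ∨ (x ∧ z).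
Proof. exact: (boolean_axiom 6 x y z). Qed.

Lemma meetx1 x y : x ∧ (y ∨ ¬ y) = x.
Proof. exact: (boolean_axiom 8 x y x). Qed.

Lemma joinx0 x y : x ∨ (y ∧ ¬ y) = x.
Proof. exact: (boolean_axiom 9 x y x). Qed.

(** Each of the two is neutral for joins, so their join equals both. *)
Lemma zeroE x y : x ∧ ¬ x = y ∧ ¬ y.
Proof. by rewrite -(joinx0 (x ∧ ¬ x) y) joinC joinx0. Qed.

Lemma meetxx x : x ∧ x = x.
Proof. by rewrite -{2}(joinx0 x x) meetKU. Qed.

Lemma meetx0 x y : x ∧ (y ∧ ¬ y) = x ∧ ¬ x.
Proof. by rewrite (zeroE y x) meetA meetxx. Qed.

Lemma le_trans x y z : alg_le x y -> alg_le y z -> alg_le x z.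
Proof. by rewrite /alg_le => xy yz; rewrite -{1}xy -meetA yz. Qed.

Lemma le_meet x y z : alg_le x (y ∧ z) <-> alg_le x y /\ alg_le x z.
Proof.
rewrite /alg_le meetA; split=> [xyz|[-> ->] //]; split; rewrite -{1}xyz.
  by rewrite -!meetA (meetC z) (meetA y) meetxx meetA.
by rewrite -!meetA meetxx meetA.
Qed.

Lemma le_of_diff_zero x y z : x ∧ ¬ y = z ∧ ¬ z -> alg_le x y.
Proof. by move=> xy0; rewrite /alg_le -{2}(meetx1 x y) meetUr xy0 joinx0. Qed.

Lemma le_zero x y : alg_le x (y ∧ ¬ y) -> ~ nonzero x.
Proof. by rewrite /alg_le meetx0 => x0; apply. Qed.

Lemma atom_le_compl c x : atom c -> alg_le c (¬ x) <-> ~ alg_le c x.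
Proof.
move=> [c0 at_c]; split=> [cnx cx|ncx].
  by apply: (@le_zero c x) c0; apply/le_meet.
case: (at_c x) => // cx0.
by rewrite /alg_le -{2}(meetx1 c x) meetUr cx0 joinC joinx0.
Qed.

Lemma subst_cat u v x : subst (u ++ v) x = subst u (subst v x) :> A.
Proof. by rewrite /subst foldr_cat. Qed.

Lemma subst_meet w x y : subst w (x ∧ y) = subst w x ∧ subst w y.
Proof.
elim: w => //= g w ->.
exact: (Mod_nth 0 (nth (subst w y) [:: subst w x]) (@Mod_endomorphism_axioms g)).
Qed.

Lemma subst_compl w x : subst w (¬ x) = ¬ subst w x.
Proof.
elim: w => //= g w ->.
exact: (Mod_nth 1 (fun=> subst w x) (@Mod_endomorphism_axioms g)).
Qed.

Lemma subst_le w x y : alg_le x y -> alg_le (subst w x) (subst w y).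
Proof. by rewrite /alg_le -subst_meet => ->. Qed.

(** Defining relations are axioms of [Sigma R], and composing operators respects the closure rules
    of the congruence. *)
Lemma subst_word_cong u v x : word_cong R u v -> subst u x = subst v x :> A.
Proof.
move=> uv; elim: uv x => {u v}
  [u v Ruv|u|u v _ IH|u v w _ IHu _ IHv|u u' v v' _ IHu _ IHv] x.
- have evalE w : eval (fun=> x) (word_term w) = subst w x.
    by elim: w => //= g w ->.
  rewrite -!evalE; apply: (SA_A (q := (word_term u, word_term v))).
  by do 2 (apply/In_cat; right); apply/In_map; exists (u, v).
- by [].
- by rewrite IH.
- by rewrite IHu.
- by rewrite !subst_cat IHv IHu.
Qed.

Lemma atom_covered_subst w c : (forall g, atom_covered A g) -> atom c ->
  exists b, atom b /\ alg_le c (subst w b).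
Proof.
move=> cov; elim: w c => [|g w IH] c at_c.
  by exists c; split=> //; apply: meetxx.
have [b [at_b cb]] := cov g c at_c; have [d [at_d bd]] := IH b at_b.
by exists d; split=> //; apply: le_trans cb (@subst_le [:: g] _ _ bd).
Qed.

(** If [b] were disjoint from [x], then [c] would lie below [subst w (b ∧ x)], which is zero. *)
Lemma atom_le_subst w b c x : atom b -> atom c -> alg_le c (subst w b) ->
  alg_le c (subst w x) <-> alg_le b x.
Proof.
move=> [_ at_b] [c0 _] cb; split=> [cx|bx]; last exact: le_trans cb (subst_le w bx).
case: (at_b x) => // bx0; exfalso; apply: (@le_zero c (subst w b)) c0.
by rewrite -subst_compl -subst_meet -bx0 subst_meet; apply/le_meet.
Qed.

(** If [x] is not below [y], some atom lies below [x ∧ ¬ y] and separates them. *)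
Lemma atomic_le_antisym x y : atomic A ->
  (forall a, atom a -> alg_le a x <-> alg_le a y) -> x = y.
Proof.
move=> At.
wlog suff le : x y / (forall a, atom a -> alg_le a x <-> alg_le a y) -> alg_le x y.
  move=> xy; rewrite -[x](le _ _ xy) meetC; apply: le => a /xy ->.
  by [].
move=> xy; apply: contrapT => nxy.
have [|a [at_a /le_meet[/(xy a at_a) ay any]]] := At (x ∧ ¬ y).
  by move=> /le_of_diff_zero.
by case/atom_le_compl: any.
Qed.

(** * Sufficiency: the representation on a disjoint union of squares *)

Hypotheses (At_A : atomic A) (cov_A : forall g, atom_covered A g).
Hypothesis pres_R : is_presentation R.
Variable i0 : 'I_n.

Definition map_word (t : 'I_n -> 'I_n) : word n := sval (cid (pres_R.1 t)).

Lemma map_wordK t : word_map (map_word t) =1 t.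
Proof. by rewrite /map_word; case: cid. Qed.

(** Words for the same map are congruent in a presentation, so the operator s_t does not depend on
    the word chosen for [t]. *)
Lemma subst_map_word w t x : word_map w =1 t ->
  subst (map_word t) x = subst w x.
Proof.
by move=> wt; apply/subst_word_cong/(pres_R.2 _ _) => i; rewrite wt map_wordK.
Qed.

Lemma subst_map_word_comp t g x :
  subst (map_word (t \o gen_map g)) x = subst (map_word t) (op_s A g x).
Proof.
rewrite -[op_s A g x]/(subst [:: g] x) -subst_cat; apply: subst_map_word => i.
by rewrite word_map_cat /= map_wordK.
Qed.

(* The point [q] stands for the pair of the atom [(q i0).1] and the map
   [snd \o q]. *)
Definition atom_squares : set ('I_n -> A * 'I_n) :=
  [set q : 'I_n -> A * 'I_n | atom (q i0).1 /\ forall i, (q i).1 = (q i0).1].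

Definition atom_rep_set (x : A) : set ('I_n -> A * 'I_n) :=
  atom_squares `&`
  [set q : 'I_n -> A * 'I_n | alg_le (q i0).1 (subst (map_word (snd \o q)) x)].

Definition atom_rep (x : A) : wp atom_squares :=
  exist _ (atom_rep_set x) (@subIsetl _ atom_squares _).

Lemma atom_squares_locally_square : locally_square atom_squares.
Proof.
move=> q [at_q cst_q] g; split=> [|i]; rewrite /= !cst_q //.
Qed.

Lemma atom_rep_homomorphism : homomorphism atom_rep.
Proof.
split=> [x y|x|g x]; apply: eq_exist; apply/seteqP; split=> q /=.
- by move=> [Vq]; rewrite /= subst_meet => /le_meet[].
- by move=> [[Vq qx] [_ qy]]; split=> //=; rewrite subst_meet; apply/le_meet.
- move=> [Vq] /=; rewrite subst_compl => /(atom_le_compl _ Vq.1) nqx.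
  by split=> // -[].
- move=> [Vq nqx]; split=> //=; rewrite subst_compl.
  by apply/(atom_le_compl _ Vq.1) => qx; apply: nqx.
- move=> [Vq qx]; split=> //; split; first exact: atom_squares_locally_square.
  by rewrite /= Vq.2 (subst_map_word_comp (snd \o q)).
- by move=> [Vq [_]]; rewrite /= Vq.2 (subst_map_word_comp (snd \o q)).
Qed.

Lemma atom_point c (t : 'I_n -> 'I_n) : atom c ->
  atom_squares (fun i => (c, t i)).
Proof. by split. Qed.

Lemma atom_rep_inj : injective atom_rep.
Proof.
move=> x y /(congr1 sval) /= /seteqP xy; apply: atomic_le_antisym => // a at_a.
(* The identity map in the square of [a] tests [alg_le a z] directly, as the empty word denotes the
   identity. *)
have pE z : alg_le a z <-> atom_rep_set z (fun i => (a, i)).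
  rewrite /atom_rep_set /= (@subst_map_word [::]) //.
  by split=> [az|[]//]; split=> //; apply: atom_point.
by rewrite !pE; split; [apply: xy.1|apply: xy.2].
Qed.

Lemma atom_rep_complete : complete atom_rep.
Proof.
move=> X m [lb_m glb_m] /=; apply/seteqP; split=> q /=.
  move=> [Vq qm]; split=> // x /lb_m mx; split=> //.
  by apply: le_trans qm (subst_le _ mx).
move=> [Vq qX]; split=> //=.
(* One atom [b] serves all of [X]: [q] lies in the image of [x] iff [b] is below [x], so [b] is a
   lower bound of [X]. *)
have [b [at_b qb]] := atom_covered_subst (map_word (snd \o q)) cov_A Vq.1.
apply/(atom_le_subst _ at_b Vq.1 qb)/glb_m => x Xx.
by apply/(atom_le_subst _ at_b Vq.1 qb); case: (qX x Xx).
Qed.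

Lemma atomic_completely_representable : completely_representable A.
Proof.
exists (A * 'I_n)%type, atom_squares, atom_rep; split; last exact: atom_rep_complete.
split; [exact: atom_squares_locally_square|exact: atom_rep_homomorphism|].
exact: atom_rep_inj.
Qed.

End SubstitutionAlgebra.

Theorem theorem3p17 (n : nat) (hn : (2 <= n)%N)
    (R : seq (word n * word n)) (hR : is_presentation R) :
  elementary (CSA R) /\ finitely_axiomatizable (CSA R).
Proof.
have fin_ax : axiomatizes [set p | List.In p (CSA_axioms R)] (CSA R).
  split=> [p|A]; first exact: CSA_axioms_sentence.
  rewrite models_CSA_axioms; split=> [[SA_A [U [V [f [rep_f comp_f]]]]]|[SA_A At cov]].
    split=> // [|g]; first exact: completely_representable_atomic rep_f comp_f.
    exact: completely_representable_atom_covered rep_f comp_f _.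
  (* As [n] is positive, 0 can serve as the index at which the atom of a point is read. *)
  by split=> //; apply: atomic_completely_representable hR (Ordinal (ltnW hn)).
split; first by exists [set p | List.In p (CSA_axioms R)].
by exists (CSA_axioms R).
Qed.
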